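(* Let $n,k\ge 1$ be integers, let $P\in\mathbb C[z]$ have degree $n$, let $\xi\in\mathbb C$, and let $Q$ be the unique polynomial of degree $n$, with the same leading coefficient as $P$, satisfying $$\frac{\mathrm d^k}{\mathrm dz^k}\bigl((z-\xi)^kQ(z)\bigr)=(n+1)_k\,P(z).$$ Let $S_{n,k}(w)=\sum_{j=0}^n\binom{n+k}{j+k}w^j$. Assume that $Z(P)\subset\overline D(c,r)$ with $c\in\mathbb C$ and $r\ge 0$. Then $$Z(Q)\subset\bigcup_{\beta\in Z(S_{n,k})}\overline D\bigl(\xi-\beta(c-\xi),\,r|\beta|\bigr).\qquad( * )$$ If $P(z)=\lambda(z-c)^n$ with $\lambda\in\mathbb C$, $\lambda\ne 0$, then $( * )$ is exact with $r=0$, including multiplicities: $$Z(Q)=\{\xi-(c-\xi)\beta:\beta\in Z(S_{n,k})\}$$ as multisets (zeros counted with multiplicity on both sides). More generally, if $r>0$, then every boundary point of every disc on the right-hand side of $( * )$ is attained as a zero of the polynomial $Q$ corresponding (for the same $n,k,\xi$) to some polynomial $P(z)=(z-p)^n$ with $p\in\partial D(c,r)$.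
   Context: $(a)_k:=a(a+1)\cdots(a+k-1)$ denotes the rising factorial. $D(c,r)=\{z\in\mathbb C:|z-c|<r\}$ and $\overline D(c,r)=\{z\in\mathbb C:|z-c|\le r\}$ (so $\overline D(c,0)=\{c\}$). $Z(F)$ denotes the zero set of a polynomial $F$, with multiplicities retained whenever explicitly stated. All polynomials have complex coefficients. For every $P$ of degree $n$ and every $\xi\in\mathbb C$, the polynomial $Q$ described in the claim exists and is unique. *)

(* Defs.v *)
From mathcomp Require Import all_boot all_order all_algebra.
From mathcomp Require Import reals complex.

Set Implicit Arguments.
Unset Strict Implicit.
Unset Printing Implicit Defensive.

Import Order.TTheory GRing.Theory Num.Theory.

Local Open Scope ring_scope.
Local Open Scope complex_scope.

(* The rising factorial (a)_k = a (a + 1) ... (a + k - 1); [ffact] in the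
   library is the falling one. *)
Definition rising_fact (a k : nat) : nat := (\prod_(i < k) (a + i))%N.

(* A radius is an element of [C]: in a [numClosedFieldType] the relation
   [x <= rho] with [0 <= x] forces [rho] to be real and nonnegative. *)
Definition closed_disc (C : numClosedFieldType) (c rho : C) : pred C :=
  [pred z | `|z - c| <= rho].

Definition circle (C : numClosedFieldType) (c rho : C) : pred C :=
  [pred z | `|z - c| == rho].

(* The zeros of a nonzero polynomial listed with multiplicity:
   [F = lead_coef F *: \prod_(z <- zeros F) ('X - z%:P)].  The order of the
   list is unspecified, so multisets of zeros are compared by [perm_eq]. *)
Definition zeros (C : closedFieldType) (F : {poly C}) : seq C :=
  sval (closed_field_poly_normal F).

Definition S_poly (C : nzRingType) (n k : nat) : {poly C} :=
  \poly_(j < n.+1) ('C(n + k, j + k))%:R.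

Definition is_companion (C : comNzRingType) (n k : nat) (xi : C)
    (P Q : {poly C}) : Prop :=
  [/\ size Q = n.+1,
      lead_coef Q = lead_coef P
    & (('X - xi%:P) ^+ k * Q)^`(k) = (rising_fact n.+1 k)%:R *: P].

Lemma rising_factE (n k : nat) : rising_fact n.+1 k = ((k + n) ^_ k)%N.
Proof.
rewrite /rising_fact; elim: k => [|k IH]; first by rewrite big_ord0 ffactn0.
by rewrite big_ord_recr /= IH ffactnS addSn /= mulnC addSn (addnC n k).
Qed.

Lemma derivn_comp_shift (C : comNzRingType) (a : C) (p : {poly C}) (k : nat) :
  (p \Po ('X + a%:P))^`(k) = p^`(k) \Po ('X + a%:P).
Proof.
elim: k => [|k IH]; first by rewrite !derivn0.
by rewrite !derivnS IH deriv_comp derivD derivX derivC addr0 mulr1.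
Qed.

(* [is_companion n k xi P] is functional and total on polynomials of
   degree [n]. *)
Lemma companion_exists_unique (C : numFieldType) (n k : nat) (xi : C)
    (P : {poly C}) :
  size P = n.+1 -> exists! Q : {poly C}, is_companion n k xi P Q.
Proof.
move=> sP.
have N0 j : ((k + j) ^_ k)%:R != 0 :> C.
  by rewrite pnatr_eq0 -lt0n ffact_gt0 leq_addr.
pose sh (p : {poly C}) := p \Po ('X + xi%:P).
have shK (p : {poly C}) : sh (p \Po ('X - xi%:P)) = p.
  by rewrite /sh -comp_polyA comp_polyB comp_polyX comp_polyC addrK comp_polyXr.
have Ksh (p : {poly C}) : sh p \Po ('X - xi%:P) = p.
  by rewrite /sh -comp_polyA comp_polyD comp_polyX comp_polyC subrK comp_polyXr.
have shinj : injective sh by apply: can_inj Ksh.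
have sX : size ('X + xi%:P) = 2.
  by rewrite -[xi]opprK polyCN size_XsubC.
have lX : lead_coef ('X + xi%:P) = 1.
  by rewrite -[xi]opprK polyCN lead_coefXsubC.
have size_sh p : size (sh p) = size p by apply: size_comp_poly2.
have lead_sh p : lead_coef (sh p) = lead_coef p.
  by rewrite /sh lead_coef_comp ?sX // lX expr1n mulr1.
have coef_sh Q j : (sh (('X - xi%:P) ^+ k * Q)^`(k))`_j
    = (sh Q)`_j *+ ((k + j) ^_ k).
  rewrite /sh -derivn_comp_shift comp_polyM rmorphXn /= comp_polyB comp_polyX.
  by rewrite comp_polyC addrK coef_derivn coefXnM ltnNge leq_addr /= addKn.
pose N : C := ((k + n) ^_ k)%:R.
pose Q' : {poly C} := \poly_(j < n.+1) (N * (sh P)`_j / ((k + j) ^_ k)%:R).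
have lP : (sh P)`_n = lead_coef P by rewrite -lead_sh lead_coefE size_sh sP.
have Q'n : N * (sh P)`_n / N = lead_coef P.
  by rewrite lP mulrAC divff ?mul1r //; apply: N0.
have lP0 : lead_coef P != 0 by rewrite lead_coef_eq0 -size_poly_gt0 sP.
exists (Q' \Po ('X - xi%:P)); split.
  split.
  - by rewrite -size_sh shK size_poly_eq // Q'n.
  - by rewrite -lead_sh shK lead_coef_poly // Q'n.
  apply: shinj; apply/polyP => j; rewrite coef_sh shK /sh linearZ coefZ -/(sh P).
  rewrite rising_factE coef_poly; case: ltnP => hj.
    by rewrite -[LHS]mulr_natr divfK.
  by rewrite [(sh P)`_j]nth_default ?size_sh ?sP // mulr0 mul0rn.
move=> Q [_ _ hQ]; apply: shinj; rewrite shK; apply/polyP => j.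
have e : N * (sh P)`_j = (sh Q)`_j * ((k + j) ^_ k)%:R.
  by rewrite mulr_natr -coef_sh hQ rising_factE /sh linearZ coefZ.
rewrite coef_poly; case: ltnP => hj; first by rewrite e mulfK.
apply: (mulIf (N0 j)); rewrite -e mul0r.
by rewrite [(sh P)`_j]nth_default ?size_sh ?sP // mulr0.
Qed.

(* Main.v *)
(* Let q(z) = Q(z + xi), p(z) = P(z + xi).  Comparing coefficients gives
   q_j 'C(n, j) = p_j 'C(n + k, j + k): q is the Szego composition of p with
   S_{n,k}.  So q(x) = 0 says that p is apolar to
   T(w) = \prod_(S(b) = 0) (x + w b), and Grace's theorem yields a zero w of T
   in the disc containing the zeros of p, i.e. x = - w b.  Grace's theorem
   follows by stripping off the zeros of p one at a time: each step replaces T by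
   a polar derivative, which by Laguerre's theorem has no zero in the disc if
   T has none.  For p = (z - a)^n the composition is explicit:
   q = \prod_(S(b) = 0) (z + a b). *)
Require Import Defs.
From mathcomp Require Import all_boot all_order all_algebra.
From mathcomp Require Import reals complex.
From mathcomp Require Import ring.

Import Order.TTheory GRing.Theory Num.Theory.

Set Implicit Arguments.
Unset Strict Implicit.

Local Open Scope ring_scope.

(** * Laguerre's theorem on polar derivatives *)

(* [h s = |v s - 1|^2 - |r s|^2] is concave in [s] when [|v| <= r], so its
   positivity passes to the mean [a]; [g] is the slope of [h] at [a]. *)
Lemma norm_affine_sum_gt (C : numClosedFieldType) (r v : C) (ss : seq C) :
  ss != [::] -> `|v| <= r -> {in ss, forall s, r * `|s| < `|v * s - 1|} ->
  r * `|\sum_(s <- ss) s| < `|v * (\sum_(s <- ss) s) - (size ss)%:R|.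
Proof.
move=> ss0 vr Hs.
have r0 : 0 <= r by apply: le_trans vr.
set S := \sum_(s <- ss) s; set N : C := (size ss)%:R.
have N0 : 0 < N by rewrite ltr0n lt0n size_eq0.
have Nz : N != 0 by rewrite gt_eqF.
pose h s := `|v * s - 1| ^+ 2 - (r * `|s|) ^+ 2.
pose a := S / N.
pose g := v * (v * a - 1)^* - r ^+ 2 * a^*.
have rc : r^* = r by apply/CrealP; rewrite ger0_real.
have h_pos s : (0 < h s) = (r * `|s| < `|v * s - 1|).
  by rewrite subr_gt0 ltr_pXn2r ?nnegrE ?mulr_ge0.
have h_expand s :
    h s = h a + (g * (s - a) + (g * (s - a))^*) - (r ^+ 2 - `|v| ^+ 2) * `|s - a| ^+ 2.
  rewrite /h /g; clear g; clearbody a.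
  rewrite !exprMn !normCK !(rmorphB, rmorphM, rmorphXn, rmorph1) /= !conjCK rc.
  by ring.
have h_le s : h s <= h a + (g * (s - a) + (g * (s - a))^*).
  rewrite h_expand gerBl mulr_ge0 ?exprn_ge0 // subr_ge0.
  by rewrite ler_pXn2r ?nnegrE.
(* Deviations from the mean cancel, so summing [h_le] kills the linear terms and bounds the mean of
   [h] by [h a]. *)
have sumd : \sum_(s <- ss) (s - a) = 0.
  rewrite sumrB -/S big_const_seq count_predT iter_addr addr0 -mulr_natr /a divfK //.
  by rewrite subrr.
have sumh : \sum_(s <- ss) h s <= h a * N.
  apply: le_trans (ler_sum _ (fun s _ => h_le s)) _.
  rewrite [leLHS]big_split [X in _ + X <= _]big_split /=.
  rewrite [X in X + _ <= _]big_const_seq count_predT iter_addr addr0.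
  have -> : \sum_(s <- ss) g * (s - a) = 0 by rewrite -mulr_sumr sumd mulr0.
  have -> : \sum_(s <- ss) (g * (s - a))^* = 0.
    by rewrite -rmorph_sum -mulr_sumr sumd mulr0 rmorph0.
  by rewrite !addr0 -mulr_natr.
have ha : 0 < h a.
  rewrite -(pmulr_lgt0 _ N0); apply: lt_le_trans sumh.
  rewrite big_seq; case: ss ss0 Hs {S N N0 Nz a g h_expand h_le sumd} => // s0 ss _ Hs.
  rewrite -big_seq big_cons ltr_wpDr ?h_pos ?Hs ?mem_head // big_seq sumr_ge0 // => s sin.
  by rewrite ltW // h_pos Hs // inE sin orbT.
have -> : v * S - N = (v * a - 1) * N by rewrite mulrBl mul1r -mulrA divfK.
have -> : S = a * N by rewrite divfK.
clear sumd; clearbody a.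
by rewrite !(normrM _ N) mulrA ltr_pM2r ?normr_gt0 // -h_pos.
Qed.

Lemma horner_deriv_prod_XsubC (F : fieldType) (ts : seq F) (w : F) :
  w \notin ts ->
  (\prod_(t <- ts) ('X - t%:P))^`().[w] =
    (\prod_(t <- ts) ('X - t%:P)).[w] * \sum_(t <- ts) (w - t)^-1.
Proof.
elim: ts => [|t ts IH]; first by rewrite !big_nil derivC horner0 mulr0.
rewrite inE negb_or => /andP[wt /IH{}IH].
rewrite !big_cons derivM derivXsubC mul1r hornerD !hornerM IH hornerXsubC.
have : w - t != 0 by rewrite subr_eq0.
by move=> ?; field.
Qed.

(** If the polar derivative vanishes at [w], then [m.+1 = (w - p) * S], where [S] sums [1 / (w - t)]
    over the zeros [t] of [T]. Each [t] lies outside the disc, so [norm_affine_sum_gt] with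
    [v = w - c] gives [r * |S| < |p - c| * |S|], contradicting the choice of [p]. *)
Lemma polar_deriv_neq0 (C : numClosedFieldType) (m : nat) (T : {poly C})
    (c r p : C) :
  (size T <= m.+2)%N -> {in closed_disc c r, forall w, T.[w] != 0} ->
  p \in closed_disc c r ->
  {in closed_disc c r, forall w,
    (T *+ m.+1 + (p%:P - 'X) * T^`()).[w] != 0}.
Proof.
move=> sT T0 pD w wD; apply/eqP => polar0.
have Tw0 := T0 w wD.
have [ts defT] := closed_field_poly_normal T.
have Tn0 : T != 0 by apply: contraNneq Tw0 => ->; rewrite horner0.
have lT0 : lead_coef T != 0 by rewrite lead_coef_eq0.
have rootE t : (T.[t] == 0) = (t \in ts).
  by rewrite -[_ == 0]/(root T t) defT rootZ // root_prod_XsubC.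
have sts : (size ts <= m.+1)%N.
  by move: sT; rewrite defT size_scale // size_prod_XsubC.
have wts : w \notin ts by rewrite -rootE.
pose S := \sum_(t <- ts) (w - t)^-1.
have dT : T^`().[w] = T.[w] * S.
  by rewrite {1}defT derivZ hornerZ horner_deriv_prod_XsubC // mulrA -hornerZ -defT.
have polarE : m.+1%:R = (w - p) * S.
  apply: (mulfI Tw0); apply/eqP; rewrite -subr_eq0 -[X in _ == X]polar0.
  rewrite hornerD hornerMn hornerM hornerD hornerN hornerC hornerX dT -mulr_natr.
  by apply/eqP; ring.
(* A degree drop puts zeros of [T] at infinity; these contribute [s = 0]. *)
pose ss := [seq (w - t)^-1 | t <- ts] ++ nseq (m.+1 - size ts) 0.
have size_ss : size ss = m.+1 by rewrite size_cat size_map size_nseq subnKC.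
have sum_ss : \sum_(s <- ss) s = S.
  by rewrite big_cat big_map /= big_nseq iter_addr_0 mul0rn addr0.
have : r * `|\sum_(s <- ss) s| < `|(w - c) * (\sum_(s <- ss) s) - (size ss)%:R|.
  apply: norm_affine_sum_gt => //; first by rewrite -size_eq0 size_ss.
  move=> s; rewrite mem_cat mem_nseq.
  move=> /orP[/mapP[t tin ->] | /andP[_ /eqP->]]; last first.
    by rewrite normr0 !mulr0 sub0r normrN1 ltr01.
  have wt : w - t != 0 by rewrite subr_eq0; apply: contraNneq wts => ->.
  have -> : (w - c) * (w - t)^-1 - 1 = (t - c) * (w - t)^-1 by field.
  rewrite normrM ltr_pM2r ?normr_gt0 ?invr_eq0 // real_ltNge ?normr_real ?ger0_real //.
    by apply: contraTN tin => tD; rewrite -rootE T0.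
  by apply: le_trans wD.
rewrite sum_ss size_ss polarE.
have -> : (w - c) * S - (w - p) * S = (p - c) * S by ring.
by move=> /lt_geF; rewrite normrM ler_wpM2r.
Qed.

(** * Apolarity and Grace's theorem *)

Lemma coef_polar_deriv (C : comNzRingType) (m j : nat) (T : {poly C}) (p : C) :
  (T *+ m + (p%:P - 'X) * T^`())`_j =
  (m%:R - j%:R) * T`_j + p * j.+1%:R * T`_j.+1.
Proof.
rewrite coefD coefMn mulrBl coefB coefCM coefXM !coef_deriv.
by case: j => [|j] /=; ring.
Qed.

(* [n!] times the usual apolar pairing, defined by the coefficients so that
   [T] and [P] may have degree less than [n]. *)
Definition apolar_form (C : nzRingType) (n : nat) (T P : {poly C}) : C :=
  \sum_(j < n.+1) (-1) ^+ j * (j`! * (n - j)`!)%:R * T`_j * P`_(n - j).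

(** The coefficient [P_(n - j)] meets [u j] through ['X * P] and [- p * u j.+1] through [- p * P].
    Extracting [j! (n - j)!] leaves the factors [n.+1 - j] and [p * j.+1] of [coef_polar_deriv]. *)
Lemma apolar_form_XsubC (C : comNzRingType) (n : nat) (T P : {poly C}) (p : C) :
  (size P <= n.+1)%N ->
  apolar_form n.+1 T (('X - p%:P) * P) =
  apolar_form n (T *+ n.+1 + (p%:P - 'X) * T^`()) P.
Proof.
move=> sP.
pose u j := (-1) ^+ j * (j`! * (n.+1 - j)`!)%:R * T`_j.
transitivity (\sum_(j < n.+2) u j * ('X * P)`_(n.+1 - j)
              - p * \sum_(j < n.+2) u j * P`_(n.+1 - j)).
  rewrite mulr_sumr -sumrB; apply: eq_bigr => j _.
  by rewrite mulrBl coefB coefCM /u; ring.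
rewrite big_ord_recr /= subnn coefXM mulr0 addr0.
rewrite [X in _ - p * X]big_ord_recl /= subn0 [P`_n.+1]nth_default // mulr0 add0r.
rewrite mulr_sumr -sumrB; apply: eq_bigr => -[j /= jn] _.
rewrite coef_polar_deriv -natrB ?(ltnW jn) // coefXM subSn //=.
rewrite /bump add1n subSS /u subSn // !factS !natrM exprS.
by ring.
Qed.

Lemma apolar_form_neq0 (C : numClosedFieldType) (T : {poly C}) (ps : seq C)
    (c r : C) :
  0 <= r -> (size T <= (size ps).+1)%N -> {subset ps <= closed_disc c r} ->
  {in closed_disc c r, forall w, T.[w] != 0} ->
  apolar_form (size ps) T (\prod_(p <- ps) ('X - p%:P)) != 0.
Proof.
move=> r0; have cD : c \in closed_disc c r by rewrite inE subrr normr0.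
elim: ps T => [|p ps IH] T sT psD T0.
  have := T0 c cD.
  rewrite /apolar_form big_nil big_ord1 (size1_polyC sT) hornerC coefC coef1 /=.
  by rewrite !fact0 !mul1r mulr1.
rewrite big_cons apolar_form_XsubC ?size_prod_XsubC //; apply: IH.
(* In degree [(size ps).+1] the factor [m - j] of [coef_polar_deriv] vanishes, so the size bound
   drops by one. *)
- apply/leq_sizeP => j; rewrite leq_eqVlt coef_polar_deriv => /orP[/eqP<- | jn].
    by rewrite subrr mul0r add0r nth_default ?mulr0.
  by rewrite !nth_default ?mulr0 ?addr0 // (leq_trans sT) // ltnW.
- by move=> q qps; apply: psD; rewrite inE qps orbT.
- apply: polar_deriv_neq0 => //; exact/psD/mem_head.
Qed.

Lemma grace_apolarity (C : numClosedFieldType) (T : {poly C}) (ps : seq C)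
    (c r : C) :
  0 <= r -> (size T <= (size ps).+1)%N -> {subset ps <= closed_disc c r} ->
  apolar_form (size ps) T (\prod_(p <- ps) ('X - p%:P)) = 0 ->
  exists2 w, w \in closed_disc c r & root T w.
Proof.
move=> r0 sT psD /eqP apolar0.
have [-> | Tn0] := eqVneq T 0; first by exists c; rewrite ?root0 // inE subrr normr0.
have [ts defT] := closed_field_poly_normal T.
have rootE w : root T w = (w \in ts).
  by rewrite defT rootZ ?lead_coef_eq0 // root_prod_XsubC.
(* The zeros of a nonzero [T] form a finite list, so a search decides whether one lies in the
   disc. *)
have [/hasP[w wts wD] | /hasPn no_root] := boolP (has (closed_disc c r) ts).
  by exists w; rewrite ?rootE.
suff: apolar_form (size ps) T (\prod_(p <- ps) ('X - p%:P)) != 0 by rewrite apolar0.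
apply: (apolar_form_neq0 r0 sT psD) => w wD; rewrite -[_ == 0]/(root T w) rootE.
by apply: contraL wD => /no_root.
Qed.

(** * The companion as a coefficientwise composition with [S_poly] *)

(** Centred at [xi], the operator is diagonal: it multiplies the coefficient of degree [j] by
    [(k + j) ^_ k]. The identity [binE] rewrites the ratio to [(k + n) ^_ k] in binomials. *)
Lemma companion_coef (C : numFieldType) (n k j : nat) (xi : C) (P Q : {poly C}) :
  is_companion n k xi P Q -> (j <= n)%N ->
  (Q \Po ('X + xi%:P))`_j * 'C(n, j)%:R =
  (P \Po ('X + xi%:P))`_j * 'C(n + k, j + k)%:R.
Proof.
move=> [_ _ hQ] jn.
have /(congr1 (fun F : {poly C} => (F \Po ('X + xi%:P))`_j)) := hQ.
rewrite -derivn_comp_shift comp_polyM rmorphXn /= comp_polyB comp_polyX comp_polyC.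
rewrite addrK coef_derivn coefXnM ltnNge leq_addr /= addKn linearZ coefZ rising_factE => e.
have binE : ('C(n + k, j + k) * (k + j) ^_ k = (k + n) ^_ k * 'C(n, j))%N.
  have jk : (j + k <= n + k)%N by rewrite leq_add2r.
  have ffactE i : ((k + i) ^_ k * i`! = (i + k)`!)%N.
    by rewrite -[in i`!](addKn k i) ffact_fact ?leq_addr // addnC.
  apply/eqP; rewrite -(eqn_pmul2r (fact_gt0 j)) -(eqn_pmul2r (fact_gt0 (n - j))).
  rewrite -!mulnA (mulnA _ _ (n - j)`!) ffactE bin_fact // ffactE.
  by rewrite -(bin_fact jk) subnDr.
have F0 : ((k + j) ^_ k)%:R != 0 :> C by rewrite pnatr_eq0 -lt0n ffact_gt0 leq_addr.
apply: (mulIf F0); rewrite -[RHS]mulrA -natrM binE natrM mulrAC.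
by rewrite [X in X * _]mulr_natr e; ring.
Qed.

(** The coefficient of degree [j] is homogeneous of degree [size bs - j] in the roots. Induction on
    the list covers [a = 0] as well. *)
Lemma coef_prod_scaled_XsubC (C : comNzRingType) (bs : seq C) (a : C) (j : nat) :
  (j <= size bs)%N ->
  (\prod_(b <- bs) ('X - (a * b)%:P))`_j =
  a ^+ (size bs - j) * (\prod_(b <- bs) ('X - b%:P))`_j.
Proof.
elim: bs j => [|b bs IH] j; first by rewrite leqn0 => /eqP->; rewrite !big_nil mul1r.
rewrite !big_cons !mulrBl !coefB !coefXM !coefCM /= => jn.
case: j jn => [|j] jn /=.
  by rewrite IH // !subn0 exprS; ring.
rewrite IH // subSS; move: jn; rewrite ltnS leq_eqVlt => /orP[/eqP-> | jn].
  by rewrite !(@nth_default _ _ _ (size bs).+1) ?size_prod_XsubC // subnn; ring.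
by rewrite IH // -(subnSK jn) exprS; ring.
Qed.

Lemma zerosE (C : closedFieldType) (F : {poly C}) :
  F = lead_coef F *: \prod_(z <- zeros F) ('X - z%:P).
Proof. exact: svalP (closed_field_poly_normal F). Qed.

Lemma S_poly_zeros (C : numClosedFieldType) (n k : nat) :
  S_poly C n k = \prod_(b <- zeros (S_poly C n k)) ('X - b%:P).
Proof.
have lS : lead_coef (S_poly C n k) = 1 by rewrite lead_coef_poly // binn ?oner_neq0.
by rewrite [LHS]zerosE lS scale1r.
Qed.

Lemma size_zeros_S_poly (C : numClosedFieldType) (n k : nat) :
  size (zeros (S_poly C n k)) = n.
Proof.
apply: succn_inj; rewrite -(size_prod_XsubC _ id) -S_poly_zeros size_poly_eq //.
by rewrite binn oner_neq0.
Qed.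

Lemma coef_prod_zeros_S_poly (C : numClosedFieldType) (n k j : nat) (a : C) :
  (j <= n)%N ->
  (\prod_(b <- zeros (S_poly C n k)) ('X - (a * b)%:P))`_j =
  a ^+ (n - j) * 'C(n + k, j + k)%:R.
Proof.
move=> jn; rewrite coef_prod_scaled_XsubC size_zeros_S_poly // -S_poly_zeros.
by rewrite coef_poly ltnS jn.
Qed.

Lemma size_comp_XaddC (C : idomainType) (a : C) (P : {poly C}) :
  size (P \Po ('X + a%:P)) = size P.
Proof. by rewrite size_comp_poly2 // size_XaddC. Qed.

Lemma comp_prod_XsubC (C : comNzRingType) (bs : seq C) (f : C -> C) (a : C) :
  (\prod_(b <- bs) ('X - (f b)%:P)) \Po ('X + a%:P) =
  \prod_(b <- bs) ('X - (f b - a)%:P).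
Proof.
rewrite rmorph_prod; apply: eq_bigr => b _ /=.
by rewrite comp_polyB comp_polyX comp_polyC polyCB opprB addrA addrAC.
Qed.

(** The binomial expansion of the shifted power supplies ['C(n, j)], which cancels in
    [companion_coef] and leaves the coefficients of [S_poly] with roots scaled by [xi - c]. *)
Lemma companion_XsubC_exp (C : numClosedFieldType) (n k : nat) (xi c a : C)
    (Q : {poly C}) :
  is_companion n k xi (a *: ('X - c%:P) ^+ n) Q ->
  Q = a *: \prod_(b <- zeros (S_poly C n k)) ('X - (xi - (c - xi) * b)%:P).
Proof.
move=> hQ; have [sQ _ _] := hQ.
have shK (F : {poly C}) : (F \Po ('X + xi%:P)) \Po ('X - xi%:P) = F.
  by rewrite -comp_polyA comp_polyD comp_polyX comp_polyC subrK comp_polyXr.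
rewrite -[LHS]shK -[RHS]shK; congr (_ \Po _); rewrite linearZ /= comp_prod_XsubC.
have -> : \prod_(b <- zeros (S_poly C n k)) ('X - (xi - (c - xi) * b - xi)%:P) =
    \prod_(b <- zeros (S_poly C n k)) ('X - ((xi - c) * b)%:P).
  by apply: eq_bigr => b _; congr ('X - _%:P); ring.
apply/polyP => j; have [jn | nj] := leqP j n; last first.
  rewrite coefZ !nth_default ?mulr0 ?size_prod_XsubC ?size_zeros_S_poly //.
  by rewrite size_comp_XaddC sQ.
have B0 : 'C(n, j)%:R != 0 :> C by rewrite pnatr_eq0 -lt0n bin_gt0.
apply: (mulIf B0); rewrite (companion_coef hQ jn) coefZ coef_prod_zeros_S_poly //.
rewrite linearZ coefZ rmorphXn /= comp_polyB comp_polyX comp_polyC.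
have -> : 'X + xi%:P - c%:P = (xi - c)%:P + 'X by rewrite polyCB; ring.
rewrite exprDn coef_sum (bigD1 (Ordinal (jn : (j < n.+1)%N))) //= big1 => [|i /eqP ij].
  rewrite -rmorphXn coefMn coefCM coefXn eqxx mulr1 -[_ *+ 'C(n, j)]mulr_natr.
  by ring.
rewrite coefMn -rmorphXn coefCM coefXn; case: eqP => [ji|]; last by rewrite mulr0 mul0rn.
by case: ij; apply: val_inj.
Qed.

(** * Locating the zeros of the companion *)

Lemma apolar_formZ (C : comNzRingType) (n : nat) (T P : {poly C}) (a : C) :
  apolar_form n T (a *: P) = a * apolar_form n T P.
Proof. by rewrite mulr_sumr; apply: eq_bigr => j _; rewrite coefZ; ring. Qed.

Lemma companion_root_disc (C : numClosedFieldType) (n k : nat) (xi c r : C)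
    (P Q : {poly C}) (z : C) :
  size P = n.+1 -> is_companion n k xi P Q -> 0 <= r ->
  {subset root P <= closed_disc c r} -> root Q z ->
  exists2 b, root (S_poly C n k) b
    & z \in closed_disc (xi - b * (c - xi)) (r * `|b|).
Proof.
move=> sP hQ r0 PD Qz; have [sQ _ _] := hQ.
have [ps defP] := closed_field_poly_normal P.
have lP0 : lead_coef P != 0 by rewrite lead_coef_eq0 -size_poly_gt0 sP.
have sps : size ps = n by move: sP; rewrite defP size_scale // size_prod_XsubC => -[].
pose qs := [seq p - xi | p <- ps].
have sqs : size qs = n by rewrite size_map.
have qsD : {subset qs <= closed_disc (c - xi) r}.
  move=> _ /mapP[p pin ->]; rewrite inE opprB addrA subrK.
  by apply: PD; rewrite -topredE /= defP rootZ // root_prod_XsubC.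
have shP : P \Po ('X + xi%:P) = lead_coef P *: \prod_(q <- qs) ('X - q%:P).
  by rewrite {1}defP linearZ /= comp_prod_XsubC big_map.
pose x := z - xi.
(* These are the coefficients in [w] of the product of the [x + w * b] over the zeros [b] of
   [S_poly]. *)
pose T : {poly C} :=
  \poly_(j < n.+1) ((-1) ^+ j * ('C(n + k, n - j + k)%:R * x ^+ (n - j))).
have apolarT : apolar_form (size qs) T (\prod_(q <- qs) ('X - q%:P)) = 0.
  apply: (mulfI lP0); rewrite mulr0 -apolar_formZ -shP sqs /apolar_form.
  (* The signs of [T] and of the form cancel, and [j! (n - j)! 'C(n, j) = n!] matches
     [companion_coef]. *)
  transitivity (n`!%:R * (Q \Po ('X + xi%:P)).[x]); last first.
    by rewrite horner_comp hornerD hornerX hornerC subrK (rootP Qz) mulr0.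
  rewrite (@horner_coef_wide _ n.+1) ?size_comp_XaddC ?sQ // mulr_sumr.
  rewrite (reindex_inj rev_ord_inj) /=; apply: eq_bigr => -[j /= ltjn] _.
  have jn : (j <= n)%N := ltjn.
  rewrite coef_poly subSS ltnS leq_subr subKn // -(bin_fact jn) !natrM.
  transitivity (((-1) ^+ (n - j) * (-1) ^+ (n - j)) * (j`!%:R * (n - j)`!%:R) * x ^+ j
     * ((P \Po ('X + xi%:P))`_j * 'C(n + k, j + k)%:R)); first by ring.
  by rewrite -(companion_coef hQ jn) -expr2 sqrr_sign; ring.
have [|w wD Tw] := grace_apolarity r0 _ qsD apolarT.
  by rewrite sqs size_poly.
(* [T.[w]] is also the value at [x] of the monic polynomial with roots [- w * b]. *)
have : root (\prod_(b <- zeros (S_poly C n k)) ('X - (- w * b)%:P)) x.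
  rewrite /root -(rootP Tw) (@horner_coef_wide _ n.+1) ?size_prod_XsubC;
    last by rewrite size_zeros_S_poly.
  rewrite horner_poly (reindex_inj rev_ord_inj) /=; apply/eqP.
  apply: eq_bigr => -[j /= jn] _.
  rewrite subSS coef_prod_zeros_S_poly ?leq_subr // subKn // [(- w) ^+ j]exprNn.
  by ring.
rewrite -(big_map (fun b => - w * b) xpredT (fun b => 'X - b%:P)) root_prod_XsubC.
move=> /mapP[b bin xE]; exists b.
  by rewrite S_poly_zeros root_prod_XsubC.
rewrite inE.
have -> : z - (xi - b * (c - xi)) = (c - xi - w) * b.
  by rewrite -[z](subrK xi) -/x xE; ring.
by rewrite normrM ler_wpM2r // distrC.
Qed.

(** * Inclusion, exact case and attained boundary points *)

Unset Implicit Arguments.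
Set Strict Implicit.

Local Open Scope complex_scope.

Theorem corollary3p4 (R : realType) (n k : nat) (hn : (1 <= n)%N)
    (hk : (1 <= k)%N) (xi c : R[i]) :
  [/\ forall (P Q : {poly R[i]}) (r : R),
        size P = n.+1 ->
        is_companion n k xi P Q ->
        0 <= r ->
        (forall z : R[i], root P z -> z \in closed_disc c r%:C) ->
        forall z : R[i], root Q z ->
          exists2 beta : R[i], root (S_poly R[i] n k) beta
            & z \in closed_disc (xi - beta * (c - xi)) (r%:C * `|beta|),
      forall (lambda : R[i]) (Q : {poly R[i]}),
        lambda != 0 ->
        is_companion n k xi (lambda *: ('X - c%:P) ^+ n) Q ->
        perm_eq (zeros Q)
          [seq xi - (c - xi) * beta | beta <- zeros (S_poly R[i] n k)]
    & forall r : R, 0 < r ->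
        forall beta : R[i], root (S_poly R[i] n k) beta ->
        forall w : R[i],
          w \in circle (xi - beta * (c - xi)) (r%:C * `|beta|) ->
          exists2 p : R[i], p \in circle c r%:C
            & exists2 Q : {poly R[i]},
                is_companion n k xi (('X - p%:P) ^+ n) Q & root Q w].
Proof.
split.
- move=> P Q r sP hQ r0 PD z Qz.
  by apply: (companion_root_disc sP hQ) => //; rewrite lecR.
- move=> a Q a0 hQ; apply: prod_XsubC_eq; apply: (scalerI a0).
  rewrite big_map -(companion_XsubC_exp hQ).
  have := zerosE Q.
  case: hQ => _ -> _; rewrite lead_coefZ lead_coef_exp lead_coefXsubC expr1n mulr1.
  by move=> <-.
move=> r r0 b Sb w /eqP wD.
(* The constant term of [S_poly] is ['C(n + k, k)], which is positive. *)
have b0 : b != 0.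
  apply: contraTneq Sb => ->; rewrite /root horner_coef0 coef_poly /= add0n.
  by rewrite pnatr_eq0 -lt0n bin_gt0 leq_addl.
(* Solves [w = xi - (p - xi) * b], the zero that [b] yields for [('X - p%:P) ^+ n]. *)
pose p := xi - (w - xi) / b.
exists p.
  rewrite inE; apply/eqP.
  have -> : p - c = - (w - (xi - b * (c - xi))) / b by rewrite /p; field.
  by rewrite normrM normrN normfV wD mulfK ?normr_eq0.
have sp : size (('X - p%:P) ^+ n) = n.+1 by rewrite size_exp_XsubC.
have [Q [hQ _]] := companion_exists_unique k xi sp.
exists Q => //; move: hQ; rewrite -[_ ^+ n]scale1r => /companion_XsubC_exp->.
rewrite scale1r -(big_map (fun b => xi - (p - xi) * b) xpredT (fun b => 'X - b%:P)).
rewrite root_prod_XsubC; apply/mapP; exists b.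
  by rewrite -root_prod_XsubC -S_poly_zeros.
by rewrite /p; field.
Qed.
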